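(* For a junction with incoming roads $1,\ldots,n$ and outgoing roads $n+1,\ldots,n+m$, write $H_{i,j}(t):=H\big(u_{hi}^-(b_i,t),u_{hj}^+(a_j,t)\big)$ and consider the $\alpha$-outside Godunov junction fluxes $$H_j(t)=\sum_{i=1}^{n}\alpha_{j,i}H_{i,j}(t)\ (j=n+1,\ldots,n+m),\qquad H_i(t)=\sum_{j=n+1}^{n+m}\alpha_{j,i}H_{i,j}(t)\ (i=1,\ldots,n).$$ Then for all $j=n+1,\ldots,n+m$, $$H_j(t)=\sum_{i=1}^n\alpha_{j,i}H_i(t)+E_j(t),$$ where $$E_j(t)=\sum_{i=1}^n\sum_{\substack{l=n+1\\ l\ne j}}^{n+m}\alpha_{j,i}\alpha_{l,i}\big(H_{i,j}(t)-H_{i,l}(t)\big).$$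
   Context: Junction: $n,m\ge 1$; each road $k\in\{1,\ldots,n+m\}$ is an interval $[a_k,b_k]$; roads $1,\ldots,n$ are incoming (the junction is at their right endpoint $b_i$) and roads $n+1,\ldots,n+m$ are outgoing (the junction is at their left endpoint $a_j$). The traffic distribution coefficients $\alpha_{j,i}$ ($i=1,\ldots,n$, $j=n+1,\ldots,n+m$) satisfy $0\le\alpha_{j,i}\le1$ and $\sum_{j=n+1}^{n+m}\alpha_{j,i}=1$ for every $i$. Discrete densities: $\mathcal{T}_{hk}$ is a finite partition of $[a_k,b_k]$ into closed intervals with disjoint interiors, $S_{hk}$ is the space of functions on $[a_k,b_k]$ that are polynomials of degree at most $p$ on each element $K\in\mathcal{T}_{hk}$ (possibly discontinuous between elements), and $u_{hk}\in C^1([0,T];S_{hk})$ is the discrete (DG) density on road $k$. One-sided traces are $v^-(x)=\lim_{y\to x-}v(y)$ and $v^+(x)=\lim_{y\to x+}v(y)$. Time $t\in[0,T]$. Flux: $f\in C^1(\mathbb{R})$ has a global maximum at $u_*$, is non-decreasing on $(-\infty,u_*]$ and non-increasing on $[u_*,\infty)$. The Godunov numerical flux is $H(u^-,u^+)=\min\{f_{in}(u^-),f_{out}(u^+)\}$, where $f_{in}(u^-)=f(u^-)$ if $u^-<u_*$ and $f_{in}(u^-)=f(u_* )$ if $u^-\ge u_*$; $f_{out}(u^+)=f(u_* )$ if $u^+\le u_*$ and $f_{out}(u^+)=f(u^+)$ if $u^+>u_*$. *)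

(* Defs.v *)
From HB Require Import structures.
From mathcomp Require Import all_boot all_order all_algebra.
From mathcomp Require Import all_classical all_reals all_analysis.

Set Implicit Arguments.
Unset Strict Implicit.
Unset Printing Implicit Defensive.

Import Order.TTheory GRing.Theory Num.Theory.
Import numFieldNormedType.Exports.

Local Open Scope classical_set_scope.
Local Open Scope ring_scope.

(* A mesh of [a, b] is given by its nodes a < s_0 < ... < b, i.e. by a sequence
   s with itv_partition a b s. Its elements are the closed intervals
   [x_e, x_(e+1)], e < size s, with x = a :: s; the definition below is the
   interior of the e-th one. *)
Definition element_interior (R : realType) (a b : R) (s : seq R) (e : nat) :
    set R :=
  `]nth b (a :: s) e, nth b (a :: s) e.+1[.

Definition broken_domain (R : realType) (a b : R) (s : seq R) : set R :=
  \bigcup_(e < size s) element_interior a b s e.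

(* Functions that are polynomials of degree at most p on each element. The
   value at a node shared by two elements is left free: the polynomials of the
   two elements may disagree there, and only one-sided limits are meaningful. *)
Definition dg_space (R : realType) (p : nat) (a b : R) (s : seq R) :
    set (R -> R) :=
  [set v | forall e, (e < size s)%N ->
     exists q : {poly R}, (size q <= p.+1)%N /\
       forall x, element_interior a b s e x -> v x = q.[x] ].

(* u in C^1([0, T]; S), with S = dg_space p a b s. The norm on the
   finite-dimensional space S is the sup norm over the union of the element
   interiors (nodal values are irrelevant), and the derivative is one-sided at
   the endpoints of [0, T]. *)
Definition dg_C1 (R : realType) (T : R) (p : nat) (a b : R) (s : seq R)
    (u : R -> R -> R) : Prop :=
  (forall t : R, t \in `[0, T] -> dg_space p a b s (u t)) /\
  exists du : R -> R -> R,
    [/\ forall t : R, t \in `[0, T] -> dg_space p a b s (du t),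
        forall t : R, t \in `[0, T] ->
          {uniform broken_domain a b s,
            (fun r : R => fun x : R => (u r x - u t x) / (r - t))
              @ within `[0, T] t^' --> du t}
      & forall t : R, t \in `[0, T] ->
          {uniform broken_domain a b s,
            du @ within `[0, T] (nbhs t) --> du t}].

Definition ltrace (R : realType) (v : R -> R) (x : R) : R :=
  lim (v y @[y --> x^'-]).

Definition rtrace (R : realType) (v : R -> R) (x : R) : R :=
  lim (v y @[y --> x^'+]).

Definition C1_real (R : realType) (f : R -> R) : Prop :=
  (forall x, derivable f x 1) /\ continuous (derive1 f).

Definition flux_shape (R : realType) (f : R -> R) (us : R) : Prop :=
  [/\ forall x, f x <= f us,
      forall x y, x <= y -> y <= us -> f x <= f y
    & forall x y, us <= x -> x <= y -> f y <= f x].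

Definition f_in (R : realType) (f : R -> R) (us u : R) : R :=
  if u < us then f u else f us.

Definition f_out (R : realType) (f : R -> R) (us u : R) : R :=
  if u <= us then f us else f u.

Definition godunov (R : realType) (f : R -> R) (us ul ur : R) : R :=
  Num.min (f_in f us ul) (f_out f us ur).

(* Roads are indexed by 'I_(n + m): lshift m i is the i-th incoming road and
   rshift n j the j-th outgoing one. Densities are u k t x (road, time, space),
   and alpha j i is the share of traffic from incoming road i going to outgoing
   road j. *)

Definition distribution_coeffs (R : realType) (n m : nat) (alpha : 'M[R]_(m, n)) :
    Prop :=
  (forall j i, 0 <= alpha j i <= 1) /\ (forall i, \sum_(j < m) alpha j i = 1).

Definition Hpair (R : realType) (n m : nat) (f : R -> R) (us : R)
    (a b : 'I_(n + m) -> R) (u : 'I_(n + m) -> R -> R -> R)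
    (i : 'I_n) (j : 'I_m) (t : R) : R :=
  godunov f us (ltrace (u (lshift m i) t) (b (lshift m i)))
               (rtrace (u (rshift n j) t) (a (rshift n j))).

Definition Hout (R : realType) (n m : nat) (f : R -> R) (us : R)
    (alpha : 'M[R]_(m, n)) (a b : 'I_(n + m) -> R)
    (u : 'I_(n + m) -> R -> R -> R) (j : 'I_m) (t : R) : R :=
  \sum_(i < n) alpha j i * Hpair f us a b u i j t.

Definition Hin (R : realType) (n m : nat) (f : R -> R) (us : R)
    (alpha : 'M[R]_(m, n)) (a b : 'I_(n + m) -> R)
    (u : 'I_(n + m) -> R -> R -> R) (i : 'I_n) (t : R) : R :=
  \sum_(j < m) alpha j i * Hpair f us a b u i j t.

Definition Eout (R : realType) (n m : nat) (f : R -> R) (us : R)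
    (alpha : 'M[R]_(m, n)) (a b : 'I_(n + m) -> R)
    (u : 'I_(n + m) -> R -> R -> R) (j : 'I_m) (t : R) : R :=
  \sum_(i < n) \sum_(l < m | l != j)
    alpha j i * alpha l i * (Hpair f us a b u i j t - Hpair f us a b u i l t).

(* Main.v *)
Require Import Defs.
From HB Require Import structures.
From mathcomp Require Import all_boot all_order all_algebra.
From mathcomp Require Import all_classical all_reals all_analysis.

Import Order.TTheory GRing.Theory Num.Theory.
Import numFieldNormedType.Exports.

Local Open Scope classical_set_scope.
Local Open Scope ring_scope.

(** The identity already holds for each incoming road [i] separately. As the shares [alpha l i] sum
    to 1 over [l], the flux [Hin] of road [i] is a weighted mean of its pair fluxes, and
    [deviation_from_mean] writes the pair flux towards [j] as this mean plus weighted deviations.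
    Multiplying by [alpha j i] and summing over [i] gives the claim. *)

Lemma deviation_from_mean (R : pzRingType) (I : finType) (j : I) (w h : I -> R) :
  \sum_l w l = 1 ->
  h j = \sum_l w l * h l + \sum_(l | l != j) w l * (h j - h l).
Proof.
move=> w1.
(* The term [l = j] is zero, so the sum may run over all indices. *)
have -> : \sum_(l | l != j) w l * (h j - h l) = \sum_l w l * (h j - h l).
  by rewrite [RHS](bigD1 j) //= subrr mulr0 add0r.
(* Writing [h j] as [(\sum_l w l) * h j] makes both sides sums over [l], equal term by term. *)
rewrite -big_split /= -[LHS]mul1r -w1 big_distrl /=.
by apply: eq_bigr => l _; rewrite mulrBr addrC subrK.
Qed.

Theorem lemma14 (R : realType) (n m : nat) (n_gt0 : (0 < n)%N) (m_gt0 : (0 < m)%N)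
    (a b : 'I_(n + m) -> R) (ab : forall k, a k < b k)
    (alpha : 'M[R]_(m, n)) (alphaP : distribution_coeffs alpha)
    (T : R) (T_gt0 : 0 < T) (p : nat)
    (mesh : 'I_(n + m) -> seq R)
    (meshP : forall k, itv_partition (a k) (b k) (mesh k))
    (u : 'I_(n + m) -> R -> R -> R)
    (uP : forall k, dg_C1 T p (a k) (b k) (mesh k) (u k))
    (f : R -> R) (f_C1 : C1_real f)
    (us : R) (f_shape : flux_shape f us) :
  forall t : R, t \in `[0, T] -> forall j : 'I_m,
    Hout f us alpha a b u j t =
      \sum_(i < n) alpha j i * Hin f us alpha a b u i t
      + Eout f us alpha a b u j t.
Proof.
move=> t _ j; rewrite /Hout /Hin /Eout -big_split /=; apply: eq_bigr => i _.
set h := fun l => Hpair f us a b u i l t.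
(* The weights are column [i] of [alpha]. Only the left side is expanded, since [h j] also occurs in
   the error term. *)
rewrite -/(h j) [in LHS](deviation_from_mean _ _ j _ h (alphaP.2 i)) mulrDr; congr (_ + _).
by rewrite big_distrr; apply: eq_bigr => l _; rewrite /= mulrA.
Qed.
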